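(* Let $\Gamma = \langle n_1, n_2\rangle$ be a numerical monoid of embedding dimension $2$ with minimal generators $n_1 < n_2$. There exists $N \in \mathbb{N}$ such that for every $n \in \Gamma$ with $n > N$ the following holds: write $n = q n_1 + r$ with $q, r$ integers and $0 \le r < n_1$, and let $a \ge 0$ be the minimal non-negative integer such that $a n_1 \equiv r \pmod{n_2}$; then $\omega(n) = q + a$.
   Context: $\mathbb{N}$ denotes the set of non-negative integers. A numerical monoid is a co-finite additive submonoid $\Gamma$ of $\mathbb{N}$; $\Gamma = \langle n_1,\ldots,n_k\rangle$ means that $\Gamma$ is generated by $n_1,\ldots,n_k$. The minimal generators are the irreducible elements of $\Gamma$, and the embedding dimension is the number of minimal generators. For $\vec a = (a_1,\ldots,a_k) \in \mathbb{N}^k$, write $|\vec a| = \sum_{i=1}^k a_i$. $\omega$-primality (for $\Gamma$ with minimal generators $n_1,\ldots,n_k$; here $k=2$): for nonzero $n \in \Gamma$, $\omega(n)$ is the smallest positive integer $m$ with the property that whenever $\vec a \in \mathbb{N}^k$ satisfies $\sum_{i=1}^k a_i n_i - n \in \Gamma$ and $|\vec a| > m$, there exists $\vec b \in \mathbb{N}^k$ with $b_i \le a_i$ for each $i$ such that $\sum_{i=1}^k b_i n_i - n \in \Gamma$ and $|\vec b| \le m$; if no such $m$ exists, $\omega(n) = \infty$. Also $\omega(0) = 0$. *)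

(* Defs.v *)
From HB Require Import structures.
From mathcomp Require Import all_boot.
From mathcomp Require Import boolp classical_sets functions cardinality.

Set Implicit Arguments.
Unset Strict Implicit.
Unset Printing Implicit Defensive.

Local Open Scope classical_set_scope.

Definition numerical_monoid (G : set nat) : Prop :=
  [/\ G 0, forall x y : nat, G x -> G y -> G (x + y) & cofinite_set G].

Definition norm1 (k : nat) (a : {ffun 'I_k -> nat}) : nat := \sum_(i < k) a i.

Definition lincomb (k : nat) (g : k.-tuple nat) (a : {ffun 'I_k -> nat}) : nat :=
  \sum_(i < k) a i * tnth g i.

Definition generated (k : nat) (g : k.-tuple nat) : set nat := range (lincomb g).

Definition irreducibles (G : set nat) : set nat :=
  [set x | [/\ G x, x <> 0 &
    forall y z : nat, G y -> G z -> x = y + z -> y = 0 \/ z = 0]].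

Definition minimal_generators (G : set nat) (k : nat) (g : k.-tuple nat) : Prop :=
  uniq g /\ irreducibles G = [set` g].

Definition has_embedding_dimension (G : set nat) (k : nat) : Prop :=
  (irreducibles G #= `I_k)%card.

(* "x - n \in G" for the integer difference; the guard n <= x is needed
   because subtraction on nat is truncated and 0 \in G. *)
Definition diff_in (G : set nat) (x n : nat) : Prop := n <= x /\ G (x - n).

Definition omega_bound (G : set nat) (k : nat) (g : k.-tuple nat) (n m : nat) : Prop :=
  forall a : {ffun 'I_k -> nat},
    diff_in G (lincomb g a) n -> m < norm1 a ->
    exists b : {ffun 'I_k -> nat},
      [/\ forall i : 'I_k, b i <= a i, diff_in G (lincomb g b) n & norm1 b <= m].

(* None stands for infinity. The tuple g is meant to list the minimal
   generators of G, and n to be an element of G. *)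
Definition omega (G : set nat) (k : nat) (g : k.-tuple nat) (n : nat) : option nat :=
  if n == 0 then Some 0
  else if pselect (exists m, (0 < m) && `[< omega_bound G g n m >]) is left exm
       then Some (ex_minn exm)
       else None.

(* Main.v *)
Require Import Defs.
From mathcomp Require Import all_boot.
From mathcomp Require Import boolp classical_sets functions cardinality.
From mathcomp Require Import zify.

(** Write [n = q * n1 + r]. Call a pair [(x, y)] admissible when
    [x * n1 + y * n2 - n] lies in the monoid, that is, when
    [x * n1 + y * n2 = n + u * n1 + v * n2] for some natural [u] and [v].
    Then [omega] is the largest norm [x + y] of an admissible pair that is
    minimal for the componentwise order. Cancelling the terms common to both
    sides shows that below every admissible pair there is one of three kinds:
    - a factorization [x * n1 + y * n2 = n], of norm at most [q] since
      [n1 < n2];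
    - a pair [(x, 0)] with [x * n1 = n + v * n2]; these are exactly the pairs
      for which [x - q] is a natural number with [(x - q) * n1] congruent to
      [r] modulo [n2], so the least of them is [(q + a, 0)];
    - a pair [(0, y)] with [y * n2 = n + u * n1]; one may take [u < n2], so
      that [y] is at most [n / n2] up to an additive constant, and this is
      below [q], the integer part of [n / n1], as soon as [n] is large.
    Hence [q + a] is a bound ([omega_bound_quotient]). No smaller number is
    one, because nothing admissible lies strictly below [(q + a, 0)]
    ([omega_bound_ge]). *)

(** * The value of omega as a least bound *)

Lemma omegaE {G : set nat} {k : nat} {g : k.-tuple nat} {n w : nat} :
  0 < n -> 0 < w -> omega_bound G g n w ->
  (forall m, omega_bound G g n m -> w <= m) ->
  omega G g n = Some w.
Proof.
move=> n_gt0 w_gt0 bw least_w; rewrite /omega gtn_eqF //.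
case: pselect => [exm|[]]; last by exists w; rewrite w_gt0; apply/asboolP.
case: ex_minnP => m /andP[_ /asboolP bm] min_m; congr Some.
apply/eqP; rewrite eqn_leq least_w // andbT.
by apply: min_m; rewrite w_gt0; apply/asboolP.
Qed.

(** * Exponent vectors of length two *)

Definition pair2 (x y : nat) : {ffun 'I_2 -> nat} :=
  [ffun i => if i == ord0 then x else y].

Lemma norm1_pair (c : {ffun 'I_2 -> nat}) :
  norm1 c = c ord0 + c ord_max.
Proof.
by rewrite /norm1 big_ord_recr big_ord1; congr (c _ + c _); apply: val_inj.
Qed.

Lemma lincomb_pair n1 n2 (c : {ffun 'I_2 -> nat}) :
  lincomb [tuple n1; n2] c = c ord0 * n1 + c ord_max * n2.
Proof.
rewrite /lincomb big_ord_recr big_ord1 /= !(tnth_nth 0) /=.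
by congr (c _ * _ + c _ * _); apply: val_inj.
Qed.

Lemma generated_pair n1 n2 z :
  generated [tuple n1; n2] z <-> exists u v, z = u * n1 + v * n2.
Proof.
split=> [[c _ <-]|[u [v ->]]].
  by exists (c ord0), (c ord_max); rewrite lincomb_pair.
by exists (pair2 u v) => //; rewrite lincomb_pair !ffunE.
Qed.

Lemma diff_in_pair n1 n2 (c : {ffun 'I_2 -> nat}) n :
  diff_in (generated [tuple n1; n2]) (lincomb [tuple n1; n2] c) n <->
  exists u v, c ord0 * n1 + c ord_max * n2 = n + u * n1 + v * n2.
Proof.
rewrite /diff_in generated_pair lincomb_pair.
split=> [[le_n [u [v def_z]]]|[u [v def_z]]].
  by exists u, v; rewrite -addnA -def_z subnKC.
by split; [lia | exists u, v; lia].
Qed.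

Lemma leq_pair2 x y (c : {ffun 'I_2 -> nat}) :
  x <= c ord0 -> y <= c ord_max -> forall i, pair2 x y i <= c i.
Proof.
move=> le_x le_y i; rewrite ffunE; case: eqP => [->//|/eqP nz_i].
suff -> : i = ord_max by [].
by case: i nz_i => [[|[|i]] ltj] // _; apply: val_inj.
Qed.

(** * Admissible pairs on the two axes *)

(** The congruence only says that [n2] divides a difference of either sign;
    that the difference is nonnegative uses [r < n2], since a value
    [a * n1 < r < n2] congruent to [r] would have to equal [r]. *)
Lemma first_axis_admissible {n1 n2 q r a} :
  r < n2 -> a * n1 = r %[mod n2] ->
  exists v, (q + a) * n1 = q * n1 + r + v * n2.
Proof.
move=> lt_r_n2 cong_a.
have le_r : r <= a * n1.
  by rewrite leqNgt; apply/negP=> lt_r; move: cong_a; rewrite !modn_small; lia.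
have /dvdnP[v def_v] : n2 %| a * n1 - r.
  by rewrite -(eqn_mod_dvd n2 le_r); apply/eqP.
by exists v; rewrite mulnDl; lia.
Qed.

Lemma first_axis_minimal {n1 n2 q r a x v} :
  0 < n1 ->
  (forall b, b * n1 = r %[mod n2] -> a <= b) ->
  x * n1 = q * n1 + r + v * n2 -> q + a <= x.
Proof.
move=> n1_gt0 min_a def_x.
have le_qx : q <= x.
  by rewrite -(leq_pmul2r n1_gt0) def_x -addnA leq_addr.
have /min_a : (x - q) * n1 = r %[mod n2]; last by lia.
by rewrite mulnBl def_x -addnA addKn addnC modnMDl.
Qed.

(** Subtracting [n2] from [u] amounts to subtracting [n1] from [y], so [u] may
    be replaced by its remainder modulo [n2]. *)
Lemma second_axis_reduce {n1 n2 n y u} :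
  0 < n2 -> y * n2 = n + u * n1 ->
  exists y' u', [/\ y' <= y, u' < n2 & y' * n2 = n + u' * n1].
Proof.
move=> n2_gt0 def_y; exists (y - u %/ n2 * n1), (u %% n2).
split; rewrite ?leq_subr ?ltn_mod //.
by rewrite mulnBl def_y {1}(divn_eq u n2) mulnDl mulnAC addnCA addKn.
Qed.

(** * The two bounds *)

(** Whatever lies below [(q + a, 0)] is on the first axis. *)
Lemma omega_bound_ge {n1 n2 q r a m} :
  0 < n1 -> r < n2 -> a * n1 = r %[mod n2] ->
  (forall b, b * n1 = r %[mod n2] -> a <= b) ->
  omega_bound (generated [tuple n1; n2]) [tuple n1; n2] (q * n1 + r) m ->
  q + a <= m.
Proof.
move=> n1_gt0 lt_r cong_a min_a bm; rewrite leqNgt; apply/negP => lt_m.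
have [v def_v] := first_axis_admissible (q := q) lt_r cong_a.
have [||b []] := bm (pair2 (q + a) 0).
- by apply/diff_in_pair; exists 0, v; rewrite !ffunE /=; lia.
- by rewrite norm1_pair !ffunE /= addn0.
move=> le_b /diff_in_pair[u [w def_b]]; rewrite norm1_pair.
have := le_b ord_max; rewrite ffunE /= leqn0 => /eqP b1; rewrite b1 in def_b *.
have -> : b ord0 + 0 = b ord0 - u + u by nia.
suff : q + a <= b ord0 - u by lia.
by apply: (first_axis_minimal (v := w) n1_gt0 min_a); nia.
Qed.

(** The lower bound on [q] makes the pairs on the second axis harmless:
    [u < n2] gives [y * n2 < q * n1 + n1 + n1 * n2], which is at most
    [q * n1 + q], hence at most [q * n2]. *)
Lemma omega_bound_quotient {n1 n2 q r a} :
  n1 < n2 -> r < n1 -> n1 * n2.+1 <= q -> 0 < q ->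
  a * n1 = r %[mod n2] ->
  (forall b, b * n1 = r %[mod n2] -> a <= b) ->
  omega_bound (generated [tuple n1; n2]) [tuple n1; n2] (q * n1 + r) (q + a).
Proof.
move=> lt_n12 lt_r le_q q_gt0 cong_a min_a c /diff_in_pair[u [v def_c]] _.
have n1_gt0 : 0 < n1 by lia.
have below x y u' v' : x <= c ord0 -> y <= c ord_max -> x + y <= q + a ->
    x * n1 + y * n2 = q * n1 + r + u' * n1 + v' * n2 ->
    exists b : {ffun 'I_2 -> nat},
      [/\ forall i, b i <= c i,
          diff_in (generated [tuple n1; n2]) (lincomb [tuple n1; n2] b)
                  (q * n1 + r)
        & norm1 b <= q + a].
  move=> le_x le_y le_xy def_xy; exists (pair2 x y); split.
  - exact: leq_pair2.
  - by apply/diff_in_pair; exists u', v'; rewrite !ffunE.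
  - by rewrite norm1_pair !ffunE.
move: (c ord0) (c ord_max) def_c below => x y def_xy below.
have [le_ux|/ltnW le_xu] := leqP u x; have [le_vy|/ltnW le_yv] := leqP v y.
- (* Full cancellation leaves a factorization. *)
  have def_n : (x - u) * n1 + (y - v) * n2 = q * n1 + r.
    by move: (leq_mul le_ux (leqnn n1)) (leq_mul le_vy (leqnn n2));
      rewrite !mulnBl; lia.
  apply: (below (x - u) (y - v) 0 0); [lia| lia| |lia].
  have le_n12 : (y - v) * n1 <= (y - v) * n2.
    by rewrite leq_mul2l (ltnW lt_n12) orbT.
  have : (x - u + (y - v)) * n1 < q.+1 * n1 by rewrite mulnDl mulSn; lia.
  by rewrite ltn_mul2r => /andP[_]; lia.
- have def_x : (x - u) * n1 = q * n1 + r + (v - y) * n2.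
    by move: (leq_mul le_ux (leqnn n1)) (leq_mul le_yv (leqnn n2));
      rewrite !mulnBl; lia.
  have le_qa := first_axis_minimal n1_gt0 min_a def_x.
  have [w def_w] :=
    first_axis_admissible (q := q) (ltn_trans lt_r lt_n12) cong_a.
  by apply: (below (q + a) 0 0 w); lia.
- have def_y : (y - v) * n2 = q * n1 + r + (u - x) * n1.
    by move: (leq_mul le_xu (leqnn n1)) (leq_mul le_vy (leqnn n2));
      rewrite !mulnBl; lia.
  have [|y' [u' [le_y' lt_u' def_y']]] := second_axis_reduce _ def_y; first lia.
  apply: (below 0 y' u' 0); [lia| lia| |lia].
  have le_u' : u' * n1 <= n2 * n1 by rewrite leq_mul2r ltnW ?orbT.
  have le_qn : q * n1 + q <= q * n2 by rewrite -mulnSr leq_mul2l lt_n12 orbT.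
  have : y' * n2 < q.+1 * n2 by move: le_q; rewrite mulnS mulSn; lia.
  by rewrite ltn_mul2r => /andP[_]; lia.
- (* Full cancellation would leave [q * n1 + r] equal to at most zero. *)
  have qn1_gt0 : 0 < q * n1 by rewrite muln_gt0 q_gt0.
  by move: (leq_mul le_xu (leqnn n1)) (leq_mul le_yv (leqnn n2)); lia.
Qed.

Theorem theorem4p4 (G : set nat) (n1 n2 : nat)
    (Gmon : numerical_monoid G)
    (Ggen : G = generated [tuple n1; n2])
    (Gdim : has_embedding_dimension G 2)
    (Gmin : minimal_generators G [tuple n1; n2])
    (lt_n12 : n1 < n2) :
  exists N : nat, forall n : nat, G n -> N < n ->
    forall q r a : nat,
      n = q * n1 + r -> r < n1 ->
      a * n1 = r %[mod n2] ->
      (forall b : nat, b * n1 = r %[mod n2] -> a <= b) ->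
      omega G [tuple n1; n2] n = Some (q + a).
Proof.
(* The threshold is chosen to force [n1 * n2.+1 <= q]. *)
exists (n1 * (n1 * n2.+1).+1) => n _ lt_Nn q r a def_n lt_r cong_a min_a.
have le_q : n1 * n2.+1 <= q.
  have : n1 * (n1 * n2.+1).+1 < n1 * q.+1 by nia.
  by rewrite ltn_mul2l => /andP[_]; lia.
have q_gt0 : 0 < q by nia.
rewrite Ggen; apply: omegaE => [||| m bm]; [lia | lia | |]; last first.
  by rewrite def_n in bm; apply: (omega_bound_ge _ _ cong_a min_a bm); lia.
by rewrite def_n; exact: omega_bound_quotient.
Qed.
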